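(* Let $p$ be a positive prime integer, $\epsilon$ a generator of $\mathbb{U}_p$, $M$ a divisor of $p-1$, $\mathbb{M}$ a multiplicative subgroup of $\mathbb{U}_p$ of order $M$, and $a:=\frac{p-1}{M}$ the index of $\mathbb{M}$ in $\mathbb{U}_p$. Let $\Delta_{\mathbb{M}}:=\mathbb{M}\times\mathbb{Z}_p$ and let $\mathbf{y}\in\mathbb{C}^p$ be a non-zero window signal. The finite wavelet system $\mathcal{W}(\mathbf{y},\Delta_{\mathbb{M}})$ is a frame for $\mathbb{C}^p$ if and only if the following conditions hold: (i) $\widehat{\mathbf{y}}(0)\neq 0$; (ii) for each $t\in\{0,\ldots,a-1\}$ there exists $m_t\in\mathbb{M}$ such that $\widehat{\mathbf{y}}(\epsilon^t m_t)\neq 0$.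
   Context: For a prime $p$, $\mathbb{Z}_p=\{0,\ldots,p-1\}$ denotes the integers modulo $p$ and $\mathbb{U}_p=\mathbb{Z}_p\setminus\{0\}$ is the multiplicative group modulo $p$ (cyclic of order $p-1$). $\mathbb{C}^p$ denotes the space of functions $\mathbf{x}:\mathbb{Z}_p\to\mathbb{C}$ with inner product $\langle\mathbf{x},\mathbf{y}\rangle=\sum_{k=0}^{p-1}\mathbf{x}(k)\overline{\mathbf{y}(k)}$ and induced norm $\|\cdot\|_2$. For $k\in\mathbb{Z}_p$ the translation operator is $T_k\mathbf{x}(s)=\mathbf{x}(s-k)$, and for $m\in\mathbb{U}_p$ the cyclic dilation operator is $D_m\mathbf{x}(s)=\mathbf{x}(m_p s)$, where $m_p$ is the inverse of $m$ in $\mathbb{U}_p$ (all arguments modulo $p$). The unitary discrete Fourier transform of $\mathbf{x}$ is $\widehat{\mathbf{x}}(\ell)=\frac{1}{\sqrt{p}}\sum_{k=0}^{p-1}\mathbf{x}(k)e^{-2\pi i\ell k/p}$ for $\ell\in\mathbb{Z}_p$. A window signal is just a vector of $\mathbb{C}^p$. For $\Delta\subseteq\mathbb{U}_p\times\mathbb{Z}_p$, the finite wavelet system is the family $\mathcal{W}(\mathbf{y},\Delta)=\{T_kD_m\mathbf{y}:(m,k)\in\Delta\}$, indexed by $\Delta$. A finite family $\{\mathbf{y}_j\}_{j=0}^{N-1}$ in $\mathbb{C}^p$ is a frame for $\mathbb{C}^p$ if there is a constant $0<A<\infty$ with $A\|\mathbf{x}\|_2^2\le\sum_{j=0}^{N-1}|\langle\mathbf{x},\mathbf{y}_j\rangle|^2$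 for all $\mathbf{x}\in\mathbb{C}^p$. *)

(* Defs.v *)
From HB Require Import structures.
From mathcomp Require Import all_boot all_order all_algebra all_fingroup.
From mathcomp Require Import all_solvable.
From mathcomp Require Import reals trigo.
From mathcomp Require Import complex.

Set Implicit Arguments.
Unset Strict Implicit.
Unset Printing Implicit Defensive.

Import Order.TTheory GRing.Theory Num.Theory.

Local Open Scope ring_scope.

                                                                               
                                                        
Notation signal R p := {ffun 'F_p -> R[i]}.

Definition inner (R : realType) (p : nat) (x y : signal R p) : R[i] :=
  \sum_(k : 'F_p) x k * (y k)^*.

Definition norm2 (R : realType) (p : nat) (x : signal R p) : R[i] :=
  sqrtC (inner x x).

Definition translation (R : realType) (p : nat) (k : 'F_p) (x : signal R p)
    : signal R p :=
  [ffun s => x (s - k)].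

Definition dilation (R : realType) (p : nat) (m : {unit 'F_p})
    (x : signal R p) : signal R p :=
  [ffun s => x (val m^-1%g * s)].

Definition expi (R : realType) (theta : R) : R[i] :=
  (cos theta +i* sin theta)%C.

                                                                          
Definition dft (R : realType) (p : nat) (x : signal R p) : signal R p :=
  [ffun l : 'F_p => ((Num.sqrt p%:R)^-1)%:C%C *
     \sum_(k : 'F_p) x k * expi (- (2 * pi * (l : nat)%:R * (k : nat)%:R / p%:R))].

                                                                            
                        
Definition is_frame (R : realType) (p : nat) (I : finType) (D : {set I})
    (f : I -> signal R p) : Prop :=
  exists A : R, 0 < A /\
    forall x : signal R p,
      A%:C%C * norm2 x ^+ 2 <= \sum_(j in D) `|inner x (f j)| ^+ 2.

                                                                        
Definition wavelet (R : realType) (p : nat) (y : signal R p)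
    (d : {unit 'F_p} * 'F_p) : signal R p :=
  translation d.2 (dilation d.1 y).

(* Main.v *)
Require Import Defs.
From HB Require Import structures.
From mathcomp Require Import all_boot all_order all_algebra all_fingroup.
From mathcomp Require Import all_solvable.
From mathcomp Require Import reals trigo.
From mathcomp Require Import complex.

Set Implicit Arguments.
Unset Strict Implicit.
Unset Printing Implicit Defensive.

Import Order.TTheory GRing.Theory Num.Theory.

Local Open Scope ring_scope.

(** The Fourier transform turns the dilation by [m] of the window into the
    inverse dilation of its spectrum, and a translation into a modulation:
    the transform of [T_k D_m y] at [l] is [chi (- l * k)] times the transform
    of [y] at [m * l], where [chi z] is [exp (2 i pi z / p)].  For fixed [m],
    the coefficients of [x] against all translates are therefore, up to the
    factor [sqrt p], the transform of [l |-> dft x l * (dft y (m * l))^*], so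
    that Plancherel's formula sums their squares ([sum_translations]).
    Summing over [m] gives [sum_wavelets]: the frame operator is diagonal in
    the Fourier basis, and its eigenvalue at the frequency [l] is [p] times
    the energy of the spectrum of [y] on [{m * l : m in MM}].

    The system is thus a frame exactly when none of these energies vanishes
    ([wavelet_frameP]).  At [l = 0] the energy only sees [dft y 0].  At
    [l != 0] it only depends on the coset of [l] modulo [MM], and since the
    unit group is generated by [eps], the powers [eps ^+ t] with
    [t < #|G : MM|] meet every coset ([cyclic_coset_repr]): this leaves the
    two conditions of the theorem. *)

(** * The additive characters of the prime field *)

Lemma expiD (R : realType) (s t : R) : expi (s + t) = expi s * expi t.
Proof.
rewrite /expi cosD sinD; apply/eqP; rewrite eq_complex /= eqxx /=.
by rewrite addrC [cos s * _]mulrC.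
Qed.

Lemma expiMn (R : realType) (t : R) n : expi (t *+ n) = expi t ^+ n.
Proof.
elim: n => [|n IHn]; first by rewrite mulr0n expr0 /expi cos0 sin0.
by rewrite mulrS exprS expiD IHn.
Qed.

Lemma expiN (R : realType) (t : R) : expi (- t) = (expi t)^*.
Proof. by rewrite /expi cosN sinN. Qed.

Lemma norm_expi (R : realType) (t : R) : `|expi t| = 1.
Proof. by rewrite normc_def /= cos2Dsin2 sqrtr1. Qed.

(** The exponent is the representative of [z] in [0 .. p-1]; any other one
    would give the same value, which is the content of [chi_nat] below. *)
Definition additive_char (R : realType) (p : nat) (z : 'F_p) : R[i] :=
  expi (2 * pi / p%:R) ^+ z.

Section Fourier.

Context (R : realType) (p : nat) (hp : prime p).

Local Notation chi := (@additive_char R p).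
Local Notation c := (((Num.sqrt p%:R)^-1)%:C%C : R[i]).

Implicit Types (x y : signal R p) (l k z : 'F_p) (m : {unit 'F_p}).
Implicit Types MM : {set {unit 'F_p}}.

Lemma expi_root1 : expi (2 * pi / p%:R : R) ^+ p = 1.
Proof.
have p_neq0 : p%:R != 0 :> R by rewrite pnatr_eq0 -lt0n prime_gt0.
rewrite -expiMn -[X in expi X]mulr_natr divfK // mulr_natl /expi cos2pi.
by rewrite mulr2n sinDpi sinpi oppr0.
Qed.

Lemma chi_nat n : chi n%:R = expi (2 * pi / p%:R) ^+ n.
Proof.
by rewrite /additive_char val_Fp_nat // expr_mod // expi_root1.
Qed.

Lemma chi0 : chi 0 = 1.
Proof. by rewrite /additive_char expr0. Qed.

Lemma chiD z1 z2 : chi (z1 + z2) = chi z1 * chi z2.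
Proof. by rewrite -[z1]natr_Zp -[z2]natr_Zp -natrD !chi_nat exprD. Qed.

Lemma norm_chi z : `|chi z| = 1.
Proof. by rewrite normrX norm_expi expr1n. Qed.

Lemma chiN z : chi (- z) = (chi z)^*.
Proof.
have nz : chi z != 0 by rewrite -normr_eq0 norm_chi oner_eq0.
apply: (mulfI nz); rewrite -chiD subrr chi0.
by rewrite -normCK norm_chi expr1n.
Qed.

(** The angle [2 pi / p] lies in [(0, pi]] because [p >= 2], and the cosine is
    injective on [[0, pi]]. *)
Lemma chi1_neq1 : chi 1 != 1.
Proof.
rewrite -[chi 1]/(chi 1%:R) chi_nat expr1.
apply/eqP => -[cos1 _].
have p0 : 0 < p%:R :> R by rewrite ltr0n prime_gt0.
have t0 : 0 < 2 * pi / p%:R :> R by rewrite !mulr_gt0 ?pi_gt0 ?invr_gt0.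
have tpi : 2 * pi / p%:R <= pi :> R.
  rewrite ler_pdivrMr // mulrC ler_pM2l ?pi_gt0 //.
  by rewrite ler_nat prime_gt1.
have: 2 * pi / p%:R = 0 :> R.
  apply: cos_inj; last by rewrite cos1 cos0.
    by rewrite in_itv /= tpi ltW.
  by rewrite in_itv /= lexx pi_ge0.
by move/eqP; rewrite gt_eqF.
Qed.

(** Orthogonality of characters.  For [l != 0] the sum runs over all values of
    [chi], and shifting the index by 1 multiplies it by [chi 1 != 1]. *)
Lemma sum_chi l : \sum_k chi (l * k) = if l == 0 then p%:R else 0.
Proof.
have [->|l0] := eqVneq.
  under eq_bigr do rewrite mul0r chi0.
  by rewrite sumr_const card_Fp.
rewrite -(reindex_inj (h := *%R l) (P := predT) (F := chi) (mulfI l0)).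
have shift : \sum_k chi k = chi 1 * \sum_k chi k.
  rewrite [LHS](reindex_inj (addrI 1)) mulr_sumr.
  by apply: eq_bigr => k _; rewrite chiD.
have := chi1_neq1; rewrite -subr_eq0 => /mulfI inj.
by apply: inj; rewrite mulr0 mulrBl mul1r -shift subrr.
Qed.

(** * The Fourier transform and Plancherel's formula *)

Lemma dftE x l : dft x l = c * \sum_k x k * (chi (l * k))^*.
Proof.
rewrite ffunE; congr (_ * _); apply: eq_bigr => k _; congr (_ * _).
rewrite expiN -[l in RHS]natr_Zp -[k in RHS]natr_Zp -natrM chi_nat -expiMn.
congr (expi _)^*; rewrite -[RHS]mulr_natr natrM.
by rewrite -[X in X / _]mulrA [LHS]mulrAC.
Qed.

Lemma sqr_dft_const : c * c = p%:R^-1.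
Proof.
rewrite -rmorphM /= -invfM -expr2 sqr_sqrtr ?ler0n //.
by rewrite fmorphV rmorph_nat.
Qed.

(** Expanding both transforms, the sum over frequencies of [chi (l * (k - j))]
    vanishes unless [k = j], by orthogonality. *)
Lemma plancherel x y : inner (dft x) (dft y) = inner x y.
Proof.
have pC : p%:R != 0 :> R[i] by rewrite pnatr_eq0 -lt0n prime_gt0.
have term l : dft x l * (dft y l)^* =
    p%:R^-1 * \sum_j \sum_k x j * (y k)^* * chi (l * (k - j)).
  rewrite !dftE rmorphM /= [c^*]conjc_real mulrACA sqr_dft_const.
  congr (_ * _); rewrite mulr_suml; apply: eq_bigr => j _.
  rewrite rmorph_sum mulr_sumr; apply: eq_bigr => k _.
  by rewrite rmorphM /= conjCK mulrBr chiD chiN mulrACA [_^* * chi _]mulrC.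
rewrite /inner; under eq_bigr do rewrite term.
rewrite -mulr_sumr exchange_big /=; apply: (mulfI pC); rewrite mulVKf //.
rewrite mulr_sumr; apply: eq_bigr => j _.
rewrite exchange_big /= (bigD1 j) //= [X in _ + X]big1 ?addr0 => [|k kj].
  rewrite -mulr_sumr subrr; under eq_bigr do rewrite mulr0 chi0.
  by rewrite sumr_const card_Fp // mulrC.
rewrite -mulr_sumr; under eq_bigr do rewrite mulrC.
by rewrite sum_chi subr_eq0 (negPf kj) mulr0.
Qed.

Lemma inner_self x : inner x x = \sum_k `|x k| ^+ 2.
Proof. by apply: eq_bigr => k _; rewrite normCK. Qed.

(** * Wavelet systems in the frequency domain *)

Lemma val_unit_neq0 m : val m != 0 :> 'F_p.
Proof. by rewrite -unitfE (valP m). Qed.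

(** The substitution [s = m * t + k] undoes the translation and the dilation;
    the phase [l * s] becomes [(m * l) * t + l * k]. *)
Lemma dft_wavelet y m k l :
  dft (wavelet y (m, k)) l = (chi (l * k))^* * dft y (val m * l).
Proof.
rewrite !dftE mulrCA; congr (_ * _).
have inj : injective (fun s : 'F_p => val m * s + k).
  by move=> s t /addIr /(mulfI (val_unit_neq0 m)).
rewrite (reindex_inj inj) mulr_sumr; apply: eq_bigr => s _.
rewrite !ffunE addrK -[val (m, k).1^-1%g]/(val m)^-1 mulKf ?val_unit_neq0 //.
rewrite mulrDr chiD rmorphM /= [RHS]mulrCA; congr (_ * _).
by rewrite [LHS]mulrC mulrCA mulrA.
Qed.

(** By Plancherel the left-hand side is a sum over frequencies with phase
    [chi (l * k)]: a transform evaluated at [- k], which lacks only its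
    normalizing factor. *)
Lemma inner_wavelet x y m k :
  inner x (wavelet y (m, k)) =
  c^-1 * dft [ffun l => dft x l * (dft y (val m * l))^*] (- k).
Proof.
have c0 : c != 0.
  by rewrite fmorph_eq0 invr_eq0 sqrtr_eq0 -ltNge ltr0n prime_gt0.
rewrite -plancherel dftE mulKf //; apply: eq_bigr => l _.
rewrite dft_wavelet [X in _ = X * _]ffunE rmorphM /= conjCK mulNr chiN.
rewrite conjCK [k * l]mulrC.
by rewrite -mulrA [chi _ * _]mulrC.
Qed.

(** Plancherel's formula applied to the signal of [inner_wavelet]. *)
Lemma sum_translations x y m :
  \sum_k `|inner x (wavelet y (m, k))| ^+ 2 =
  p%:R * \sum_l `|dft x l| ^+ 2 * `|dft y (val m * l)| ^+ 2.
Proof.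
set G := [ffun l => dft x l * (dft y (val m * l))^*] : signal R p.
have cV : `|c^-1| ^+ 2 = p%:R.
  by rewrite normfV exprVn normCK [c^*]conjc_real sqr_dft_const invrK.
under eq_bigr do rewrite inner_wavelet normrM exprMn cV.
rewrite -mulr_sumr (reindex_inj oppr_inj); congr (_ * _).
under eq_bigr do rewrite opprK.
rewrite -inner_self plancherel inner_self; apply: eq_bigr => l _.
by rewrite [G l]ffunE normrM norm_conjC exprMn.
Qed.

(** Up to the factor [p], the eigenvalue at the frequency [l] of the frame
    operator of the system over [MM] times all translations. *)
Definition dilation_energy (MM : {set {unit 'F_p}}) y l : R[i] :=
  \sum_(m in MM) `|dft y (val m * l)| ^+ 2.

Lemma sum_wavelets (MM : {set {unit 'F_p}}) x y :
  \sum_(d in setX MM [set: 'F_p]) `|inner x (wavelet y d)| ^+ 2 =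
  p%:R * \sum_l `|dft x l| ^+ 2 * dilation_energy MM y l.
Proof.
transitivity (\sum_(m in MM) \sum_k `|inner x (wavelet y (m, k))| ^+ 2).
  rewrite pair_big /=; apply: eq_big => [[m k]|[m k] _] //=.
  by rewrite in_setX inE.
under eq_bigr do rewrite sum_translations.
rewrite -mulr_sumr exchange_big; congr (_ * _).
by apply: eq_bigr => l _; rewrite mulr_sumr.
Qed.

Lemma dilation_energy_ge0 MM y l : 0 <= dilation_energy MM y l.
Proof. by apply: sumr_ge0 => m _; rewrite exprn_ge0. Qed.

Lemma dilation_energy_gt0P MM y l :
  reflect (exists2 m, m \in MM & dft y (val m * l) != 0)
          (0 < dilation_energy MM y l).
Proof.
rewrite lt0r dilation_energy_ge0 andbT /dilation_energy.
rewrite psumr_neq0 => [|m _]; last by rewrite exprn_ge0.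
apply: (iffP hasP) => [[m _ /andP[mM]]|[m mM nz]].
  by rewrite lt0r expf_eq0 normr_eq0 => /andP[nz _]; exists m.
by exists m; rewrite ?mem_index_enum // mM exprn_gt0 ?normr_gt0.
Qed.

Lemma sqr_norm2 x : norm2 x ^+ 2 = \sum_l `|dft x l| ^+ 2.
Proof. by rewrite /norm2 sqrtCK -plancherel inner_self. Qed.

Lemma dft_pure_wave l0 l :
  dft [ffun k => chi (l0 * k)] l = if l == l0 then c * p%:R else 0.
Proof.
rewrite dftE.
under eq_bigr do rewrite ffunE -chiN -chiD -mulrBl.
by rewrite sum_chi subr_eq0 eq_sym; case: eqP; rewrite ?mulr0.
Qed.

(** If the energy vanishes at [l], the pure wave of frequency [l] is orthogonal
    to the whole system.  If all energies are positive, [p] times any positive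
    lower bound of them is a frame bound. *)
Lemma wavelet_frameP (MM : {set {unit 'F_p}}) y :
  is_frame (setX MM [set: 'F_p]) (wavelet y) <->
  (forall l, exists2 m, m \in MM & dft y (val m * l) != 0).
Proof.
have pC : 0 < p%:R :> R[i] by rewrite ltr0n prime_gt0.
split=> [[A [A0 frameA]] l|nz].
  apply/dilation_energy_gt0P; rewrite lt0r dilation_energy_ge0 andbT.
  apply/eqP => E0.
  have := frameA [ffun k => chi (l * k)].
  rewrite sum_wavelets sqr_norm2.
  rewrite [X in _ <= _ * X -> _]big1 => [|l' _]; last first.
    rewrite dft_pure_wave; case: eqP => [->|_]; first by rewrite E0 mulr0.
    by rewrite normr0 expr0n mul0r.
  rewrite mulr0 (bigD1 l) //= big1 => [|l' /negPf l'l]; last first.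
    by rewrite dft_pure_wave l'l normr0 expr0n.
  rewrite addr0 dft_pure_wave eqxx lt_geF //.
  rewrite mulr_gt0 ?ltcR // exprn_gt0 // normr_gt0 mulf_neq0 ?gt_eqF //.
  by rewrite ltcR invr_gt0 sqrtr_gt0 ltr0n prime_gt0.
pose W := dilation_energy MM y.
have W0 l : 0 < W l by apply/dilation_energy_gt0P.
(* The inverse of [B] bounds all the [W l] from below, without a minimum. *)
pose B := \sum_l (W l)^-1.
have WB l : (W l)^-1 <= B.
  rewrite /B (bigD1 l) //= lerDl sumr_ge0 // => l' _.
  by rewrite invr_ge0 ltW.
have B0 : 0 < B by apply: lt_le_trans (WB 0); rewrite invr_gt0.
have A0 : 0 < p%:R / B by rewrite divr_gt0.
(* Frame bounds are real numbers, whereas [W] takes complex values. *)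
have AE : (complex.Re (p%:R / B))%:C%C = p%:R / B.
  by rewrite RRe_real // gtr0_real.
exists (complex.Re (p%:R / B)); split=> [|x].
  by rewrite -ltcR AE.
rewrite AE sum_wavelets sqr_norm2 -mulrA ler_pM2l // mulr_sumr.
apply: ler_sum => l _; rewrite mulrC ler_wpM2l ?exprn_ge0 //.
by rewrite -[leRHS]invrK lef_pV2 ?posrE ?invr_gt0.
Qed.

End Fourier.

(** * Cosets in a cyclic group *)

(** The class of [u] in the quotient group has order dividing [#|G : H|]. *)
Lemma expg_index_abelian (gT : finGroupType) (G H : {group gT}) u :
  abelian G -> H \subset G -> u \in G -> (u ^+ #|G : H| \in H)%g.
Proof.
move=> abG sHG uG; have nHG := sub_abelian_norm abG sHG.
have uN := subsetP nHG u uG.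
apply: coset_idr; first by rewrite groupX.
rewrite morphX //= -card_quotient //.
by apply: expg_cardG; rewrite mem_quotient.
Qed.

(** Write [u] as a power [g ^+ n] and divide [n] by the index of [H]: the
    multiple of the index gives an element of [H], the remainder gives [t]. *)
Lemma cyclic_coset_repr (gT : finGroupType) (G H : {group gT}) g u :
  generator G g -> H \subset G -> u \in G ->
  exists2 t, (t < #|G : H|%g)%N & exists2 h, h \in H & u = (g ^+ t * h)%g.
Proof.
move=> /eqP defG sHG uG.
have gG : g \in G by rewrite defG cycle_id.
have abG : abelian G by rewrite defG cycle_abelian.
move: (uG); rewrite {1}defG => /cycleP[n ->].
exists (n %% #|G : H|%g)%N; first by rewrite ltn_mod indexg_gt0.
exists (g ^+ (n %/ #|G : H| * #|G : H|%g))%g.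
  by rewrite mulnC expgM groupX // expg_index_abelian.
by rewrite -expgD addnC -divn_eq.
Qed.

(** * The frame criterion *)

Theorem theorem3p10 (R : realType) (p : nat) (hp : prime p)
    (eps : {unit 'F_p}) (heps : generator [set: {unit 'F_p}] eps)
    (M : nat) (hM : (M %| p.-1)%N)
    (MM : {group {unit 'F_p}}) (hMM : #|MM| = M)
    (a : nat) (ha : a = (p.-1 %/ M)%N)
    (y : signal R p) (hy : y != 0) :
  is_frame (setX MM [set: 'F_p]) (wavelet y) <->
    (dft y 0 != 0 /\
     forall t : nat, (t < a)%N ->
       exists2 m : {unit 'F_p}, m \in MM & dft y (val (eps ^+ t * m)%g) != 0).
Proof.
have index_MM : (#|[set: {unit 'F_p}] : MM| = a)%g.
  rewrite ha -divgS ?subsetT // hMM; congr (_ %/ _)%N.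
  by rewrite card_finField_unit card_Fp.
apply: (iff_trans (wavelet_frameP hp MM y)); split.
  move=> nz; split=> [|t _].
    by have [m _] := nz 0; rewrite mulr0.
  have [m mM nzm] := nz (val (eps ^+ t)%g).
  by exists m => //; rewrite FinRing.val_unitM mulrC.
case=> nz0 nzt l; have [->|l0] := eqVneq l 0.
  by exists 1%g => //; rewrite mulr0.
have lU : l \is a GRing.unit by rewrite unitfE.
have [t ta [h hM' lE]] :=
  cyclic_coset_repr heps (subsetT MM) (in_setT (FinRing.unit 'F_p lU)).
have [m mM nzm] := nzt t (eq_ind _ (fun n => t < n)%N ta _ index_MM).
(* As [l = eps ^+ t * h], dilating it by [m * h^-1] gives [eps ^+ t * m]. *)
exists (m * h^-1)%g; first by rewrite groupM ?groupV.
suff <- : val (eps ^+ t * m)%g = val (m * h^-1)%g * l by [].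
rewrite -[l]/(val (FinRing.unit 'F_p lU)) lE -FinRing.val_unitM.
have mulUC (u v : {unit 'F_p}) : (u * v = v * u)%g.
  by apply: val_inj; exact: mulrC.
by congr val; rewrite [LHS]mulUC -mulgA [(h^-1 * _)%g]mulUC mulgK.
Qed.
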